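(* Let $R$ be a finite commutative local ring with identity of size $p^s$, with $p$ prime and $s\in\mathbb{N}$, having prime residue field $\mathbb{F}_p$. Let $k\in\mathbb{N}$ be such that $(k,p)=1$ and put $k'=(k,p-1)$. Then $g_R(k)$ always exists and we have the following cases: (a) If $p=2$, then for any $k$ odd we have $g_R(k)=1$ if $s=1$ and $g_R(k)=2$ if $s\ge2$. (b) If $p$ is odd, then we have two cases: (i) If $k'\mid\frac{p-1}{2}$, then $$g_R(k)=\begin{cases}1, & \text{if } k'=1 \text{ and } s=1,\\ 2, & \text{if } k'=1 \text{ and } s\ge2,\\ g(k,p), & \text{if } k'\ge2.\end{cases}$$ (ii) If $k'\nmid\frac{p-1}{2}$, then $$g_R(k)=\begin{cases}g(k,p), & \text{if } \gamma(\Gamma(k,p))\le g(k,p) \text{ or } s=1,\\ g(k,p)+1, & \text{if } \gamma(\Gamma(k,p))>g(k,p) \text{ and } s\ge2.\end{cases}$$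
   Context: $(a,b)$ denotes the greatest common divisor of integers $a$ and $b$. For a ring $A$, the Waring number $g_A(k)$ is the minimum $s_0\in\mathbb{N}$, if it exists, such that $x_1^k+\cdots+x_{s_0}^k=r$ has a solution in $A$ for every $r\in A$; $g(k,p)=g_{\mathbb{F}_p}(k)$. $\Gamma(k,p)$ is the directed graph with vertex set $\mathbb{F}_p$ and an arc from $v$ to $w$ if and only if $w-v\in\{x^k:x\in\mathbb{F}_p^*\}$; $\gamma$ of a directed graph is its girth, the length of a shortest directed cycle.
   Formalization: In the two clauses giving g_R(k)=2 for s≥2 (case (a), and case (b)(i) with k'=1) the hypothesis k≥2 is added, since for k=1 every r equals r^1, so g_R(1)=1 (e.g. R=Z/4 or Z/9). *)

(* Defs.v *)
From mathcomp Require Import all_boot all_order all_algebra.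
From mathcomp Require Import boolp.

Set Implicit Arguments.
Unset Strict Implicit.
Unset Printing Implicit Defensive.

Import GRing.Theory.
Local Open Scope ring_scope.

(* If no [n] satisfies [P], the value is 0 by convention. *)
Definition least (P : nat -> Prop) : nat :=
  if pselect (exists n, `[< P n >]) is left exP then ex_minn exP else 0%N.

(* Every element of [A] is a sum of [n] [k]-th powers, 0 allowed as a term. *)
Definition sums_of_powers (A : pzSemiRingType) (k n : nat) : Prop :=
  forall r : A, exists x : 'I_n -> A, \sum_(i < n) x i ^+ k = r.

Definition waring_exists (A : pzSemiRingType) (k : nat) : Prop :=
  exists n, sums_of_powers A k n.

Definition waring_number (A : pzSemiRingType) (k : nat) : nat :=
  least (sums_of_powers A k).

(* A loop is a directed cycle of length 1, and a pair of opposite arcs is one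
   of length 2. *)
Definition has_dicycle (V : eqType) (arc : rel V) (n : nat) : Prop :=
  exists c : seq V, [/\ size c = n, (0 < n)%N, uniq c & cycle arc c].

Definition girth (V : eqType) (arc : rel V) : nat := least (has_dicycle arc).

Definition paley_graph (k p : nat) : rel 'F_p :=
  fun v w => [exists x : 'F_p, (x != 0) && (w - v == x ^+ k)].

(* An [idealr R] is always a proper ideal. *)
Definition maximal_ideal (R : comNzRingType) (m : idealr R) : Prop :=
  forall J : idealr R, {subset m <= J} -> J =i m.

Definition local_ring (R : comNzRingType) (m : idealr R) : Prop :=
  maximal_ideal m /\ forall J : idealr R, maximal_ideal J -> J =i m.

Definition ring_isomorphic (A B : pzRingType) : Prop :=
  exists f : {rmorphism A -> B}, bijective f.

(* Main.v *)
Require Import Defs.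
From HB Require Import structures.
From mathcomp Require Import all_boot all_order all_algebra.
From mathcomp Require Import fingroup cyclic finfield boolp.

Set Implicit Arguments.
Unset Strict Implicit.
Unset Printing Implicit Defensive.
Import GRing.Theory.

(** Write [F] for the residue field and [phi : R -> F] for the reduction map,
    and consider three properties of a number [n]: (P) every element of [R] is
    a sum of [n] [k]-th powers in [R]; (Q) the same in [F]; (I) in [F], zero is
    a sum of [n] [k]-th powers that are not all zero ([isotropic] below).
    Everything follows from comparing them.

    - A unit of [R] whose residue is a [k]-th power is a [k]-th power, by
      Hensel's lemma ([kth_power_lift]; this is where [k] prime to [p] enters).
      Hence a representation in [F] that has a nonzero term lifts to [R]: lift
      all the other terms arbitrarily and let the nonzero one absorb the error
      ([sum_lift]). Nonzero residues only have such representations, and zero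
      has one exactly under (I), so (Q) and (I) imply (P).
    - Reduction shows that (P) implies (Q). If the maximal ideal is nonzero, it
      has an element that is not a sum of products of two of its members
      ([maximal_ideal_not_idempotent], a form of Nakayama's lemma). When
      [k >= 2], a representation of that element must have a term outside of
      the maximal ideal, and reducing it gives (I).

    So for [s >= 2] and [k >= 2], (P) is equivalent to (Q) and (I). A shortest
    nontrivial vanishing sum of [k]-th powers is the same thing as a shortest
    directed cycle of the Paley graph, whose vertices are the partial sums
    ([isotropic_girth]); thus (I) says that [n] is at least the girth, and the
    Waring number of [R] is the maximum of the Waring number [g] of [F] and of
    the girth ([waring_number_local]). Writing [-1] as a sum of [g] powers and
    adding [1 ^+ k] shows that the girth is at most [g + 1]. If [k'] is 1 then
    [g] is 1 and the girth is 2; if [k' >= 2] divides [(p - 1) / 2] then [-1] is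
    a [k]-th power, so that the girth is at most 2, while [g >= 2]. For [s = 1]
    the map [phi] is an isomorphism. *)

(** * Least elements *)

Lemma least_iff (P : nat -> Prop) (a : nat) :
  (forall n, P n <-> a <= n) -> least P = a.
Proof.
move=> PE; rewrite /least; case: pselect => [exP|[]]; last first.
  by exists a; apply/asboolP/PE.
case: ex_minnP => n /asboolP/PE le_an min_n; apply/eqP.
by rewrite eqn_leq le_an andbT; apply/min_n/asboolP/PE.
Qed.

Lemma leastP (P : nat -> Prop) :
  (exists n, P n) -> P (least P) /\ forall n, P n -> least P <= n.
Proof.
move=> [n0 Pn0]; rewrite /least; case: pselect => [exP|[]]; last first.
  by exists n0; apply/asboolP.
case: ex_minnP => n /asboolP Pn min_n; split=> // i Pi.
by apply/min_n/asboolP.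
Qed.

Lemma least_upward (P : nat -> Prop) n :
    (exists n0, P n0) -> (forall i j, i <= j -> P i -> P j) ->
  P n <-> least P <= n.
Proof.
by move=> /leastP[Pl minl] up; split=> [/minl|/up]; last exact.
Qed.

(** * Sums of powers *)

Section SumsOfPowers.
Local Open Scope ring_scope.

(** Lists can be padded, permuted and filtered more easily than functions
    on ordinals. *)
Lemma sums_of_powersP (A : pzSemiRingType) (k n : nat) :
  sums_of_powers A k n <->
    forall r : A, exists2 xs : seq A, size xs = n & \sum_(x <- xs) x ^+ k = r.
Proof.
split=> sumA r; have [x def_r] := sumA r.
  exists [seq x i | i <- enum 'I_n]; first by rewrite size_map size_enum_ord.
  by rewrite big_map big_enum.
move=> <-; exists (fun i => x`_i).
by rewrite (big_nth 0) big_mkord def_r.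
Qed.

Lemma sum_nseq0 (A : pzSemiRingType) (k d : nat) (xs : seq A) :
  (0 < k)%N -> \sum_(x <- xs ++ nseq d 0) x ^+ k = \sum_(x <- xs) x ^+ k.
Proof.
case: k => // k _; rewrite big_cat /= [X in _ + X]big_nseq iter_addr_0 expr0n.
by rewrite mul0rn addr0.
Qed.

Lemma sums_of_powers_leq (A : pzSemiRingType) (k i j : nat) :
  (0 < k)%N -> (i <= j)%N -> sums_of_powers A k i -> sums_of_powers A k j.
Proof.
move=> k_gt0 le_ij /sums_of_powersP sumA; apply/sums_of_powersP => r.
have [xs sz_xs def_r] := sumA r; exists (xs ++ nseq (j - i) 0).
  by rewrite size_cat size_nseq sz_xs subnKC.
by rewrite sum_nseq0.
Qed.

Definition isotropic (F : nzSemiRingType) (k n : nat) : Prop :=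
  exists xs : seq F,
    [/\ size xs = n, has (predC1 0) xs & \sum_(x <- xs) x ^+ k = 0].

Lemma isotropic_leq (F : nzSemiRingType) (k i j : nat) :
  (0 < k)%N -> (i <= j)%N -> isotropic F k i -> isotropic F k j.
Proof.
move=> k_gt0 le_ij [xs [sz_xs xs_n0 sum0]]; exists (xs ++ nseq (j - i) 0).
by rewrite size_cat size_nseq sz_xs subnKC // has_cat xs_n0 sum_nseq0.
Qed.

Lemma isotropic_gt1 (F : idomainType) (k n : nat) :
  isotropic F k n -> (1 < n)%N.
Proof.
case=> -[|x [|y xs]] [<-] //=; rewrite orbF big_seq1 => x_n0 /eqP.
by rewrite expf_eq0 (negPf x_n0) andbF.
Qed.

Lemma sums_of_powers_gt0 (A : nzSemiRingType) (k n : nat) :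
  sums_of_powers A k n -> (0 < n)%N.
Proof.
case: n => // /(_ 1)[x /eqP].
by rewrite big_ord0 eq_sym oner_eq0.
Qed.

(** The element [-1] is a sum of [n] powers, and [1] is one more power. *)
Lemma sums_of_powers_isotropic (F : nzRingType) (k n : nat) :
  sums_of_powers F k n -> isotropic F k n.+1.
Proof.
move=> /sums_of_powersP/(_ (-1))[xs sz_xs sumN1]; exists (1 :: xs).
by rewrite /= sz_xs oner_eq0 big_cons sumN1 expr1n subrr.
Qed.

Lemma sums_of_powers_morph (A B : pzSemiRingType) (f : {rmorphism A -> B})
    (k n : nat) :
    (forall b, exists a, f a = b) ->
  sums_of_powers A k n -> sums_of_powers B k n.
Proof.
move=> f_surj sumA b; have [a <-] := f_surj b; have [x <-] := sumA a.
exists (f \o x); rewrite rmorph_sum; apply: eq_bigr => i _.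
by rewrite rmorphXn.
Qed.

Lemma sums_of_powers_bij (A B : pzSemiRingType) (f : {rmorphism A -> B})
    (k n : nat) :
    injective f -> (forall b, exists a, f a = b) ->
  sums_of_powers A k n <-> sums_of_powers B k n.
Proof.
move=> f_inj f_surj; split; first exact: sums_of_powers_morph.
move=> sumB a; have [y def_fa] := sumB (f a).
have /choice[h fh] : forall i, exists x, f x = y i by move=> i; apply: f_surj.
exists h; apply: f_inj; rewrite rmorph_sum -def_fa.
by apply: eq_bigr => i _; rewrite rmorphXn fh.
Qed.

(** * Directed cycles and vanishing sums *)

Lemma paley_path_sum (k p : nat) (v : 'F_p) (c : seq 'F_p) :
    path (@paley_graph k p) v c ->
  exists xs : seq 'F_p,
    [/\ size xs = size c, all (predC1 0) xs &
        \sum_(x <- xs) x ^+ k = last v c - v].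
Proof.
elim: c v => [|w c IHc] v /=; first by exists [::]; rewrite big_nil subrr.
case/andP=> /existsP[x /andP[x_n0 /eqP def_x]] /IHc[xs [sz_xs xs_n0 def_xs]].
exists (x :: xs); rewrite /= sz_xs x_n0 big_cons def_xs -def_x addrC.
by rewrite addrA subrK.
Qed.

Lemma dicycle_isotropic (k p n : nat) :
  has_dicycle (@paley_graph k p) n -> isotropic 'F_p k n.
Proof.
case=> -[|v c] [<-] // _ _ /= /paley_path_sum[xs [sz_xs xs_n0 sum_xs]].
exists xs; rewrite sz_xs size_rcons sum_xs last_rcons subrr; split=> //.
by case: xs sz_xs xs_n0 {sum_xs} => [|x xs _ /andP[/= ->]] //; rewrite size_rcons.
Qed.

Lemma sum_paley_path (k p : nat) (v : 'F_p) (xs : seq 'F_p) :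
    all (predC1 0) xs ->
  exists c : seq 'F_p,
    [/\ size c = size xs, path (@paley_graph k p) v c &
        last v c = v + \sum_(x <- xs) x ^+ k].
Proof.
elim: xs v => [|x xs IHxs] v /=; first by exists [::]; rewrite big_nil addr0.
case/andP=> x_n0 /(IHxs (v + x ^+ k))[c [sz_c path_c last_c]].
exists (v + x ^+ k :: c); rewrite /= sz_c path_c last_c big_cons addrA andbT.
by split=> //; apply/existsP; exists x; rewrite x_n0 addrC addKr /=.
Qed.

(** The partial sums of a vanishing sum form a closed walk, and removing its
    loops leaves a cycle. *)
Lemma isotropic_dicycle (k p n : nat) : (0 < k)%N ->
    isotropic 'F_p k n ->
  exists2 i, (i <= n)%N & has_dicycle (@paley_graph k p) i.
Proof.
move=> k_gt0 [xs [<- xs_n0 sum0]]; pose ys := filter (predC1 0) xs.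
have sum_ys : \sum_(x <- ys) x ^+ k = 0.
  rewrite big_filter -[RHS]sum0 big_mkcond; apply: eq_bigr => x _ /=.
  by case: eqP => //= ->; rewrite expr0n eqn0Ngt k_gt0.
have le_ys : (size ys <= size xs)%N by rewrite size_filter count_size.
have [c [sz_c]] := sum_paley_path k 0 (filter_all (predC1 0) xs).
rewrite -/ys sum_ys addr0 in sz_c *.
case: c sz_c => [/esym|v c sz_c /= /andP[arc0v path_c] last_c].
  by move=> /eqP; rewrite size_filter eqn0Ngt -has_count xs_n0.
case/shortenP: path_c last_c => c' path_c' uniq_c' sub_c' last_c'.
exists (size (v :: c')).
  rewrite (leq_trans _ le_ys) // -sz_c /= ltnS uniq_leq_size //.
  by case/andP: uniq_c'.
by exists (v :: c'); rewrite /= rcons_path path_c' last_c'.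
Qed.

Lemma isotropic_girth (k p n : nat) : (0 < k)%N ->
    (exists n0, isotropic 'F_p k n0) ->
  isotropic 'F_p k n <-> (girth (@paley_graph k p) <= n)%N.
Proof.
move=> k_gt0 [n0 /(isotropic_dicycle k_gt0)[i0 _ cyc_i0]].
have [cyc_g min_g] := leastP (ex_intro _ i0 cyc_i0); split.
  by case/(isotropic_dicycle k_gt0)=> i le_in /min_g/leq_trans; apply.
by move/isotropic_leq; apply=> //; apply: dicycle_isotropic.
Qed.

(** * Ideals of a finite local ring *)

Section Ideals.
Variable R : finComNzRingType.
Implicit Types (S : {set R}) (x : R).

(** Unlike [idealr], the unit ideal is allowed, and ideals are values of a
    finite type. *)
Definition ideal_set S : Prop :=
  0 \in S /\ forall a, {in S &, forall u v, a * u + v \in S}.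

Definition ideal_add_principal S x : {set R} :=
  [set y | [exists a, y - a * x \in S]].

Lemma ideal_add_principalP S x y :
  reflect (exists a, y - a * x \in S) (y \in ideal_add_principal S x).
Proof. by rewrite inE; apply: existsP. Qed.

Lemma ideal_set_addl S : ideal_set S -> {in S &, forall u v, u + v \in S}.
Proof. by case=> _ cl u v Su Sv; rewrite -[u]mul1r cl. Qed.

Lemma ideal_set_mull S a x : ideal_set S -> x \in S -> a * x \in S.
Proof. by case=> S0 cl Sx; rewrite -[a * x]addr0 cl. Qed.

Lemma ideal_set_add_principal S x :
  ideal_set S -> ideal_set (ideal_add_principal S x).
Proof.
move=> [S0 cl]; split; first by apply/ideal_add_principalP; exists 0; rewrite mul0r subr0.
move=> a u v /ideal_add_principalP[b Su] /ideal_add_principalP[c Sv].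
apply/ideal_add_principalP; exists (a * b + c).
suff -> : a * u + v - (a * b + c) * x = a * (u - b * x) + (v - c * x) by apply: cl.
by rewrite mulrDl mulrBr opprD mulrA addrACA.
Qed.

Lemma sub_ideal_add_principal S x : S \subset ideal_add_principal S x.
Proof.
by apply/subsetP=> y Sy; apply/ideal_add_principalP; exists 0; rewrite mul0r subr0.
Qed.

Lemma mem_ideal_add_principal S x : ideal_set S -> x \in ideal_add_principal S x.
Proof.
by move=> [S0 _]; apply/ideal_add_principalP; exists 1; rewrite mul1r subrr.
Qed.

Lemma ideal_set0 : ideal_set [set 0].
Proof.
split; first by rewrite inE.
by move=> a u v /set1P-> /set1P->; rewrite mulr0 addr0 inE.
Qed.

Variable m : idealr R.
Hypothesis m_local : local_ring m.

Lemma proper_ideal_sub_maximal S :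
  ideal_set S -> 1 \notin S -> {subset S <= m}.
Proof.
move=> idS S'1.
pose P (T : {set R}) := `[< ideal_set T /\ 1 \notin T >].
have [T /maxsetP[/asboolP[[T0 clT] T'1] maxT] sST] : {T | maxset P T & S \subset T}.
  by apply: maxset_exists; apply/asboolP.
pose J : idealr R := HB.pack (fun x => x \in T)
  (isIdealr.Build R (fun x => x \in T) (And3 T0 T'1 clT)).
have maxJ : maximal_ideal J.
  move=> K sJK; have defT : [set x in K] = T.
    apply: maxT; last by apply/subsetP=> x Tx; rewrite inE; apply: sJK.
    apply/asboolP; rewrite inE idealr1; split=> //; split.
      by rewrite inE idealr0.
    by move=> a u v; rewrite !inE => Ku Kv; rewrite rpredD ?idealMr.
  by move=> x; rewrite -[RHS]/(x \in T) -defT inE.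
by move=> x /(subsetP sST) Tx; rewrite -(m_local.2 J maxJ).
Qed.

Lemma local_ring_unit x : x \notin m -> exists y, y * x = 1.
Proof.
move=> m'x; have idS := ideal_set_add_principal x ideal_set0.
have [/ideal_add_principalP[a]|S'1] := boolP (1 \in ideal_add_principal [set 0] x).
  by rewrite inE subr_eq0 => /eqP->; exists a.
have /negP[] := m'x; apply: proper_ideal_sub_maximal idS S'1 _ _.
exact: mem_ideal_add_principal ideal_set0.
Qed.

(** Let [J] be maximal among the ideals properly contained in [m]. If
    [a * y] with [a] and [y] in [m] were not in [J], then [J] and [a * y] would
    generate [m], and [a = r * (a * y)] modulo [J] for some [r]; but [1 - r * y]
    is a unit, so that [a], and hence [a * y], would be in [J]. *)
Lemma maximal_ideal_not_idempotent :
    (exists2 x, x \in m & x != 0) ->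
  exists J, [/\ ideal_set J, {in m &, forall x y, x * y \in J} &
                exists2 x, x \in m & x \notin J].
Proof.
move=> [z mz z_n0].
pose P (T : {set R}) := `[< ideal_set T /\ T \proper [set x in m] >].
have [|J /maxsetP[/asboolP[idJ ltJm] maxJ] _] := @maxset_exists _ P [set 0].
  apply/asboolP; split; first exact: ideal_set0.
  apply/properP; split; first by apply/subsetP=> x /set1P->; rewrite inE idealr0.
  by exists z; rewrite !inE.
have [sJm [x]] := properP ltJm; rewrite inE => mx J'x.
exists J; split=> //; last by exists x.
move=> a y ma my; apply/negPn/negP => J'ay.
have mE : a \in ideal_add_principal J (a * y).
  have idK := ideal_set_add_principal (a * y) idJ.
  have sJK := sub_ideal_add_principal J (a * y).
  have sKm : ideal_add_principal J (a * y) \subset [set x in m].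
    apply/subsetP=> u /ideal_add_principalP[r /(subsetP sJm)]; rewrite !inE => mu.
    by rewrite -[u](subrK (r * (a * y))) rpredD // !idealMr.
  apply: contraR J'ay => K'a; have <- : ideal_add_principal J (a * y) = J.
    apply: maxJ => //; apply/asboolP; split=> //.
    by apply/properP; split=> //; exists a; rewrite // inE.
  exact: mem_ideal_add_principal.
have [r Jr] := ideal_add_principalP _ _ _ mE.
have [|u u1] := @local_ring_unit (1 - r * y).
  by apply/negP=> m1; have /negP[] := idealr1 m; rewrite -(subrK (r * y) 1) rpredD ?idealMr.
case/negP: J'ay; rewrite mulrC ideal_set_mull //.
have <- : u * (a - r * (a * y)) = a.
  have -> : a - r * (a * y) = a * (1 - r * y) by rewrite mulrBr mulr1 mulrCA.
  by rewrite mulrCA u1 mulr1.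
exact: ideal_set_mull.
Qed.

End Ideals.

(** * Lifting powers along a local homomorphism *)

Section Lifting.
Variables (R : finComNzRingType) (F : fieldType) (phi : {rmorphism R -> F}).
Hypothesis phi_surj : forall a, exists x, phi x = a.
Hypothesis phi_local : forall x, phi x != 0 -> exists y, y * x = 1.
Variable k : nat.
Hypothesis k_gt0 : (0 < k)%N.
Hypothesis k_n0 : k%:R != 0 :> F.

(** On a residue class that is not zero, [x |-> x ^+ k] is injective, because
    [x ^+ k - y ^+ k] is [x - y] times an element that reduces to
    [k * b ^+ (k - 1)], hence to a unit. It maps the class of [b] to that of
    [b ^+ k]; both are finite of the same size, so it is onto. *)
Lemma kth_power_lift (b : F) (r : R) :
  b != 0 -> phi r = b ^+ k -> exists x, x ^+ k = r.
Proof.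
move=> b_n0 phi_r; have [y phi_y] := phi_surj b.
pose fib c := [set x | phi x == c].
have inj_pow : {in fib b &, injective (fun x => x ^+ k)}.
  move=> u v; rewrite !inE => /eqP phi_u /eqP phi_v /eqP.
  rewrite -subr_eq0 subrXX => /eqP uv0.
  have [|w w1] := phi_local (x := \sum_(i < k) u ^+ (k.-1 - i) * v ^+ i).
    rewrite rmorph_sum (eq_bigr (fun=> b ^+ k.-1)) => [|i _].
      by rewrite sumr_const card_ord -mulr_natl mulf_neq0 ?expf_neq0.
    rewrite rmorphM !rmorphXn phi_u phi_v -exprD subnK //.
    by rewrite -ltnS prednK.
  by apply/eqP; rewrite -subr_eq0 -[u - v]mulr1 -w1 mulrCA uv0 mulr0.
have card_fib : #|fib (b ^+ k)| = #|fib b|.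
  rewrite -[RHS](card_imset _ (addrI (y ^+ k - y))); apply: eq_card => x.
  rewrite inE; apply/eqP/imsetP => [phi_x|[z]].
    exists (x - (y ^+ k - y)); last by rewrite addrC subrK.
    by rewrite inE !rmorphB rmorphXn phi_x phi_y opprB addrCA subrr addr0.
  by rewrite inE => /eqP phi_z ->; rewrite rmorphD rmorphB rmorphXn phi_z phi_y subrK.
have : r \in fib (b ^+ k) by rewrite inE phi_r.
have /subset_leqif_card[_ ] : [set x ^+ k | x in fib b] \subset fib (b ^+ k).
  by apply/subsetP=> _ /imsetP[x + ->]; rewrite !inE rmorphXn => /eqP->.
rewrite (card_in_imset inj_pow) card_fib eqxx => /esym/subsetP sub /sub.
by case/imsetP=> x _ ->; exists x.
Qed.

Lemma sum_lift (r : R) (xs : seq F) :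
    has (predC1 0) xs -> \sum_(x <- xs) x ^+ k = phi r ->
  exists2 ys : seq R, size ys = size xs & \sum_(y <- ys) y ^+ k = r.
Proof.
case/hasP=> x xs_x /= x_n0; have /perm_to_rem xsE := xs_x.
have [psi phiK] := choice phi_surj.
rewrite (perm_big _ xsE) big_cons /= => sum_r.
pose ys := map psi (rem x xs).
have [|y def_y] := kth_power_lift (b := x) (r := r - \sum_(z <- ys) z ^+ k) x_n0.
  rewrite rmorphB rmorph_sum big_map -sum_r.
  by under [X in _ - X]eq_bigr => z _ do rewrite rmorphXn phiK; rewrite addrK.
exists (y :: ys); first by rewrite /= size_map (perm_size xsE).
by rewrite big_cons def_y subrK.
Qed.

Lemma sums_of_powers_lift (n : nat) :
  sums_of_powers F k n -> isotropic F k n -> sums_of_powers R k n.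
Proof.
move=> /sums_of_powersP sumF [zs [sz_zs zs_n0 sum0]]; apply/sums_of_powersP => r.
have [phi_r0|phi_r] := eqVneq (phi r) 0.
  by rewrite -sz_zs; apply: sum_lift; rewrite // phi_r0.
have [xs <- def_r] := sumF (phi r); apply: sum_lift => //.
apply: contraNT phi_r => /hasPn xs0; rewrite -def_r big1_seq // => x /andP[_ /xs0].
by rewrite /= negbK => /eqP->; rewrite expr0n eqn0Ngt k_gt0.
Qed.

(** The pair of [J] and [r] is what [maximal_ideal_not_idempotent] provides. As
    [k >= 2], a sum of [k]-th powers of elements of the kernel is in [J], so a
    representation of [r] has a term outside of the kernel, and its reduction
    is a nontrivial representation of 0. *)
Lemma sums_of_powers_descent (J : {set R}) (r : R) (n : nat) :
    (1 < k)%N -> ideal_set J ->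
    (forall x y, phi x = 0 -> phi y = 0 -> x * y \in J) ->
    phi r = 0 -> r \notin J ->
  sums_of_powers R k n -> isotropic F k n.
Proof.
move=> k_gt1 idJ JM phi_r J'r /sums_of_powersP/(_ r)[ys sz_ys sum_r].
exists (map phi ys); rewrite size_map; split=> //; last first.
  rewrite -[RHS]phi_r -sum_r big_map rmorph_sum.
  by apply: eq_bigr => y _; rewrite rmorphXn.
apply: contraR J'r => /hasPn ker_ys; rewrite -sum_r big_seq.
apply: (big_ind (fun x => x \in J)); first by case: idJ.
  exact: ideal_set_addl.
move=> y /(map_f phi)/ker_ys /=; rewrite negbK => /eqP ker_y.
by rewrite -(subnK k_gt1) exprD ideal_set_mull ?expr2 ?JM.
Qed.

End Lifting.

(** * Powers in a prime field *)

Lemma finField_generator (F : finFieldType) :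
  exists z : F,
    [/\ z != 0, forall a, a != 0 -> exists i, a = z ^+ i &
        forall i, z ^+ i = 1 <-> (#|F|.-1 %| i)%N].
Proof.
have /cyclicP[z defU] := field_unit_group_cyclic [set: {unit F}]%G.
exists (val z); split; first by rewrite -unitfE (valP z).
  move=> a; rewrite -unitfE => Ua.
  have /cycleP[i def_a] : FinRing.unit F Ua \in <[z]>%g by rewrite -defU inE.
  by exists i; rewrite -FinRing.val_unitX -def_a.
move=> i; rewrite -card_finField_unit defU -[#|<[z]>%g|]/(#[z]%g) order_dvdn.
rewrite -FinRing.val_unitX; split=> [zi1|/eqP-> //].
by apply/eqP/val_inj.
Qed.

Lemma exprn_gcdn (F : fieldType) (z : F) (k q : nat) :
  (0 < k)%N -> z ^+ q = 1 -> exists i, (z ^+ i) ^+ k = z ^+ gcdn k q.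
Proof.
move=> k_gt0 zq; case: (egcdnP q k_gt0) => u v def_uk _; exists u.
by rewrite -exprM def_uk exprD mulnC exprM zq expr1n mul1r.
Qed.

Lemma kth_powers_onto (F : finFieldType) (k : nat) :
  (0 < k)%N -> gcdn k #|F|.-1 = 1%N -> sums_of_powers F k 1.
Proof.
move=> k_gt0 k1; have [z [_ gen_z /(_ #|F|.-1)[_ /(_ (dvdnn _)) zq]]] :=
  finField_generator F.
have [i def_z] := exprn_gcdn k_gt0 zq; rewrite k1 expr1 in def_z.
move=> r; have [->|/gen_z[j ->]] := eqVneq r 0.
  by exists (fun=> 0); rewrite big_ord1 expr0n eqn0Ngt k_gt0.
by exists (fun=> z ^+ i ^+ j); rewrite big_ord1 exprAC def_z.
Qed.

(** If a generator [z] were a [k]-th power, its order would divide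
    [(#|F| - 1) / k']. *)
Lemma kth_powers_not_onto (F : finFieldType) (k : nat) :
  (0 < k)%N -> (1 < gcdn k #|F|.-1)%N -> ~ sums_of_powers F k 1.
Proof.
move=> k_gt0; have [z [z_n0 gen_z ord_z]] := finField_generator F.
set q := #|F|.-1 in ord_z *; set d := gcdn k q => d_gt1 /(_ z)[x].
rewrite big_ord1; move: (x ord0) => {}x def_z.
have q_gt0 : (0 < q)%N by rewrite /q ltn_predRL finNzRing_gt1.
have /gen_z[i def_x] : x != 0.
  by apply: contraNneq z_n0 => x0; rewrite -def_z x0 expf_eq0 eqxx andbT.
have : z ^+ (q %/ d) = 1.
  rewrite -def_z def_x -!exprM; apply/ord_z/dvdn_mull.
  by rewrite -(divnK (dvdn_gcdl k q)) -/d -mulnA dvdn_mull // mulnC divnK ?dvdn_gcdr.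
move/ord_z/dvdn_leq; rewrite divn_gt0 ?(ltnW d_gt1) // dvdn_leq ?dvdn_gcdr //.
by move=> /(_ isT); rewrite leqNgt ltn_Pdiv.
Qed.

(** For a generator [z], [-1] is [z ^+ (q / 2)] with [q = #|F| - 1], the only
    square root of 1 other than 1. *)
Lemma isotropic2_dvdn (F : finFieldType) (k : nat) :
    (0 < k)%N -> odd #|F| -> (gcdn k #|F|.-1 %| #|F|.-1./2)%N ->
  isotropic F k 2.
Proof.
move=> k_gt0 oddF /dvdnP[j def_h]; have [z [_ _ ord_z]] := finField_generator F.
set q := #|F|.-1 in def_h ord_z.
have q_gt0 : (0 < q)%N by rewrite /q ltn_predRL finNzRing_gt1.
have qE : q = q./2.*2.
  have /negPf q_even : ~~ odd q by rewrite -oddS /q prednK // ltnW ?finNzRing_gt1.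
  by rewrite -[LHS]odd_double_half q_even.
have h_gt0 : (0 < q./2)%N by rewrite -double_gt0 -qE.
have lt_hq : (q./2 < q)%N by rewrite [ltnRHS]qE -addnn -[ltnLHS]addn0 ltn_add2l.
have zq : z ^+ q = 1 by apply/ord_z.
have zh : z ^+ q./2 = -1.
  have : (z ^+ q./2) ^+ 2 == 1 by rewrite -exprM muln2 -qE zq.
  rewrite sqrf_eq1 => /orP[/eqP/ord_z/dvdn_leq|/eqP //].
  by move/(_ h_gt0); rewrite leqNgt lt_hq.
have [i def_z] := exprn_gcdn k_gt0 zq.
exists [:: 1; z ^+ i ^+ j]; rewrite /= oner_eq0; split=> //.
by rewrite big_cons big_seq1 expr1n (exprAC (z ^+ i)) def_z -exprM mulnC -def_h zh subrr.
Qed.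

Lemma sums_of_powers_Fp (p k : nat) :
  prime p -> (0 < k)%N -> sums_of_powers 'F_p k p.
Proof.
move=> p_pr k_gt0; apply/sums_of_powersP => r.
have le_rp : (r <= p)%N by rewrite ltnW // -[ltnRHS](Fp_cast p_pr).
exists (nseq r 1 ++ nseq (p - r) 0); first by rewrite size_cat !size_nseq subnKC.
by rewrite sum_nseq0 // big_nseq expr1n iter_addr_0 natr_Zp.
Qed.

Lemma isotropic_Fp (p k : nat) : prime p -> isotropic 'F_p k p.
Proof.
move=> p_pr; exists (nseq p 1); rewrite size_nseq has_nseq prime_gt0 //=.
by split; rewrite ?oner_eq0 // big_nseq expr1n iter_addr_0 pchar_Fp_0.
Qed.

(** * Waring numbers *)

Lemma waring_number_leq (A : pzSemiRingType) (k n : nat) :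
    (0 < k)%N -> waring_exists A k ->
  sums_of_powers A k n <-> (waring_number A k <= n)%N.
Proof.
move=> k_gt0 exA; apply: least_upward exA _ => i j.
exact: sums_of_powers_leq.
Qed.

Section Local.
Variables (p : nat) (R : finComNzRingType) (phi : {rmorphism R -> 'F_p}).
Variable m : idealr R.
Hypothesis p_pr : prime p.
Hypothesis m_local : local_ring m.
Hypothesis phi_surj : forall a, exists x, phi x = a.
Hypothesis phi_ker : forall x, (phi x == 0) = (x \in m).
Variable k : nat.
Hypothesis k_gt0 : (0 < k)%N.

Let phi_local x : phi x != 0 -> exists y, y * x = 1.
Proof. by rewrite phi_ker; apply: local_ring_unit. Qed.

Lemma waring_exists_local : coprime k p -> waring_exists R k.
Proof.
move=> co_kp; exists p; apply: (sums_of_powers_lift phi_surj phi_local) => //.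
- by rewrite -(dvdn_pcharf (pchar_Fp p_pr)) -prime_coprime // coprime_sym.
- exact: sums_of_powers_Fp.
- exact: isotropic_Fp.
Qed.

Lemma waring_number_local :
    coprime k p -> (1 < k)%N -> ~ injective phi ->
  waring_number R k =
    maxn (waring_number 'F_p k) (girth (@paley_graph k p)).
Proof.
move=> co_kp k_gt1 phi_ninj; apply: least_iff => n; rewrite geq_max.
have exF : waring_exists 'F_p k by exists p; apply: sums_of_powers_Fp.
have exI : exists n0, isotropic 'F_p k n0 by exists p; apply: isotropic_Fp.
have gF := waring_number_leq n k_gt0 exF.
have gI := isotropic_girth n k_gt0 exI.
have k_n0 : k%:R != 0 :> 'F_p.
  by rewrite -(dvdn_pcharf (pchar_Fp p_pr)) -prime_coprime // coprime_sym.
split=> [sumR|/andP[/gF sumF /gI isoF]]; last first.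
  exact: (sums_of_powers_lift phi_surj phi_local).
apply/andP; split; first by apply/gF; apply: sums_of_powers_morph phi_surj sumR.
apply/gI; have [|J [idJ JM [r mr J'r]]] := maximal_ideal_not_idempotent m_local.
  apply: contra_notP phi_ninj => m0 x y eq_phi; apply/eqP; rewrite -subr_eq0.
  apply/negPn/negP => xy_n0; case: m0; exists (x - y) => //.
  by rewrite -phi_ker rmorphB eq_phi subrr.
apply: (sums_of_powers_descent (phi := phi) k_gt1 idJ) (J'r) sumR.
  by move=> x y /eqP + /eqP; rewrite !phi_ker; apply: JM.
by apply/eqP; rewrite phi_ker.
Qed.

End Local.
End SumsOfPowers.

Theorem proposition7p6 (p s : nat) (hp : prime p)
    (R : finComNzRingType) (m : idealr R)
    (hlocal : local_ring m)
    (hcard : #|R| = p ^ s)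
    (hres : ring_isomorphic {ideal_quot m} 'F_p)
    (k : nat) (hk0 : 0 < k) (hk : coprime k p) :
  let k' := gcdn k p.-1 in
  let gR := waring_number R k in
  let g := waring_number 'F_p k in
  let gam := girth (@paley_graph k p) in
  waring_exists R k /\
  (p = 2 ->
     (s = 1 -> gR = 1) /\
     (2 <= s -> 1 < k -> gR = 2)) /\
  (odd p ->
     (k' %| p.-1./2 ->
        (k' = 1 -> s = 1 -> gR = 1) /\
        (k' = 1 -> 2 <= s -> 1 < k -> gR = 2) /\
        (2 <= k' -> gR = g)) /\
     (~~ (k' %| p.-1./2) ->
        (gam <= g \/ s = 1 -> gR = g) /\
        (g < gam -> 2 <= s -> gR = g + 1))).
Proof.
move=> k' gR g gam.
have [f [f' fK f'K]] := hres.
pose phi : {rmorphism R -> 'F_p} := (f \o \pi_({ideal_quot m})%qT)%R.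
have phi_surj a : exists x, phi x = a.
  by exists (generic_quotient.repr (f' a)); rewrite /= reprK f'K.
have phi_ker x : (phi x == 0)%R = (x \in m).
  rewrite /= -(rmorph0 f) (inj_eq (can_inj fK)) -(rmorph0 \pi_({ideal_quot m})%qT)%R.
  by rewrite -Quotient.idealrBE subr0.
have s_gt0 : 0 < s.
  by have := finNzRing_gt1 R; rewrite hcard; case: (s).
have gF n := waring_number_leq n hk0 (ex_intro _ p (sums_of_powers_Fp hp hk0)).
have gI n := isotropic_girth n hk0 (ex_intro _ p (isotropic_Fp k hp)).
rewrite -/gam in gI.
have g_gt0 : 0 < g by apply/sums_of_powers_gt0/gF.
have gam_gt1 : 1 < gam by apply/isotropic_gt1/gI.
have gam_le : gam <= g.+1 by apply/gI/sums_of_powers_isotropic/gF.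
have gR1 : s = 1 -> gR = g.
  move=> s1; apply: least_iff => n; rewrite -gF; apply: sums_of_powers_bij => //.
  have [psi phiK] := choice phi_surj.
  have psi_onto : forall x, x \in codom psi.
    by apply: (inj_card_onto (can_inj phiK)); rewrite hcard s1 card_Fp.
  move=> x y; have /codomP[a ->] := psi_onto x; have /codomP[b ->] := psi_onto y.
  by rewrite !phiK => ->.
have gR2 : 1 < s -> 1 < k -> gR = maxn g gam.
  move=> s_gt1 k_gt1; apply: (waring_number_local hp hlocal phi_surj) => //.
  move/leq_card; apply/negP; rewrite hcard card_Fp // -ltnNge -[ltnLHS]expn1.
  by rewrite ltn_exp2l // prime_gt1.
have gRE : 1 < k -> gam <= g -> gR = g.
  move=> k_gt1 le_g; have [s_le1|s_gt1] := leqP s 1.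
    by apply/gR1/eqP; rewrite eqn_leq s_le1.
  by rewrite gR2 //; apply/maxn_idPl.
have g1 : k' = 1 -> g = 1.
  move=> k1; apply/eqP; rewrite eqn_leq g_gt0 andbT; apply/gF.
  by apply: kth_powers_onto; rewrite // card_Fp.
have gam2 : k' = 1 -> gam = 2.
  by move=> /g1 gE; apply/eqP; rewrite eqn_leq gam_gt1 andbT -gE.
split; first exact: (waring_exists_local hp hlocal phi_surj).
split=> [p2|odd_p].
  have k1 : k' = 1 by rewrite /k' p2 gcdn1.
  split=> [/gR1->|s_gt1 k_gt1]; first exact: g1.
  by rewrite gR2 // g1 ?gam2.
split=> [dv_k'|ndv_k'].
  split=> [/g1 gE /gR1-> //|]; split=> [k1 s_gt1 k_gt1|k'_gt1].
    by rewrite gR2 // g1 ?gam2.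
  have k_gt1 : 1 < k by rewrite (leq_trans k'_gt1) // dvdn_leq ?dvdn_gcdl.
  apply: gRE => //; apply: (@leq_trans 2).
    by apply/gI/isotropic2_dvdn; rewrite ?card_Fp.
  rewrite ltnNge; apply/negP => /gF; apply: kth_powers_not_onto => //.
  by rewrite card_Fp.
have k_gt1 : 1 < k.
  rewrite ltn_neqAle hk0 andbT; apply: contraNneq ndv_k' => k1.
  by rewrite /k' -k1 gcd1n dvd1n.
split=> [[/gRE->|/gR1] //|lt_g s_gt1].
rewrite gR2 // addn1; apply/eqP; rewrite (maxn_idPr (ltnW lt_g)).
by rewrite eqn_leq gam_le.
Qed.
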